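(* Let $\Lambda,B,L\subset\mathbb{R}^d$ with $B,L$ finite, let $R$ be an invertible real $d\times d$ matrix such that conditions (i)--(v) of the context hold, and let $(\mu_n)_{n\ge0}$ be Borel probability measures on $\mathbb{R}^d$ with $$\mu_{n+1}=\frac1{|B|}\sum_{b\in B}\mu_n\circ\sigma_b^{-1},\qquad n=0,1,\dots .$$ Let $\Lambda_0=\Lambda$ and $\Lambda_{n+1}=\bigcup_{\ell\in L}\tau_\ell(\Lambda_n)$. Assume there are constants $0<k\le K$ such that $$k\|f\|_{\mu_0}^2\le\sum_{\lambda\in\Lambda_0}|\mathcal{F}_0f(\lambda)|^2\le K\|f\|_{\mu_0}^2\quad\text{for all } f\in L^2(\mu_0).$$ Let $\mathcal{M}=(e^{i2\pi b\cdot\ell})$ with rows indexed by $\ell\in L$ and columns by $b\in B$, and let $0<\delta\le D$ be such that the $|B|\times|B|$ matrix $\mathcal{M}^*\mathcal{M}$ satisfies $$\delta\|v\|^2\le\langle v,\mathcal{M}^*\mathcal{M}v\rangle\le D\|v\|^2\quad\text{for all } v\in\mathbb{C}^{|B|}.$$ Then $$k\left(\frac{\delta}{|B|}\right)^n\|f\|_{\mu_n}^2\le\sum_{\lambda\in\Lambda_n}|\mathcal{F}_nf(\lambda)|^2\le K\left(\frac{D}{|B|}\right)^n\|f\|_{\mu_n}^2$$ for all $f\in L^2(\mu_n)$ and each $n=0,1,\dots$.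
   Context: For $x,s\in\mathbb{R}^d$: $\sigma_b(x)=R^{-1}(x+b)$ $(b\in B)$ and $\tau_\ell(s)=R^*(s+\ell)$ $(\ell\in L)$, where $R^*$ is the transpose of $R$; $\mu\circ\sigma_b^{-1}(E)=\mu(\sigma_b^{-1}(E))$. $\|f\|_{\mu_n}^2=\int|f|^2d\mu_n$ and $\mathcal{F}_nf(\lambda)=\int f(x)\,e^{-i2\pi\lambda\cdot x}\,d\mu_n(x)$. For $S\subset\mathbb{R}^d$, $S^\circ:=\{t\in\mathbb{R}^d:t\cdot s\in\mathbb{Z}\ \forall s\in S\}$, and $S^{\circ\circ}=(S^\circ)^\circ$. Conditions: (i) the matrix $(e^{i2\pi\ell\cdot b})_{\ell\in L,b\in B}$ has rank $|B|$; (ii) $R(\Lambda^\circ)\subset\Lambda^\circ$; (iii) $B\subset\Lambda^\circ$; (iv) $L\subset (R^* )^{-1}(\Lambda^{\circ\circ})$; (v) $(\ell+\Lambda^{\circ\circ})\cap(\ell'+\Lambda^{\circ\circ})=\emptyset$ for all $\ell\ne\ell'$ in $L$. *)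

(* Defs.v *)
From HB Require Import structures.
From mathcomp Require Import all_boot all_order all_algebra.
From mathcomp Require Import finmap.
From mathcomp Require Import all_classical all_reals all_analysis.
From mathcomp Require Import complex.
Export Order.TTheory GRing.Theory Num.Theory.
Export numFieldNormedType.Exports.

Set Implicit Arguments.
Unset Strict Implicit.
Unset Printing Implicit Defensive.

Local Open Scope classical_set_scope.
Local Open Scope ring_scope.
Local Open Scope complex_scope.
Local Open Scope sesquilinear_scope.

(* R^d as column vectors, with the Borel sigma-algebra of its usual topology *)
Notation borelRd R d := (g_sigma_algebraType (@open 'cV[R]_d)).

Section Vectors.
Context {R : realType} {d : nat}.
Implicit Types (A : 'M[R]_d) (x y s b l : 'cV[R]_d) (S : set 'cV[R]_d).

Definition dot x y : R := \sum_(i < d) x i 0 * y i 0.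

Definition sigma A b x : 'cV[R]_d := invmx A *m (x + b).

Definition tau A l s : 'cV[R]_d := A^T *m (s + l).

(* the set S° of vectors having integer dot product with all of S *)
Definition polar S : set 'cV[R]_d :=
  [set t | forall s, S s -> dot t s \is a Num.int].

Definition translate l S : set 'cV[R]_d := [set l + t | t in S].

Fixpoint spectrum A (L : {fset 'cV[R]_d}) S (n : nat) : set 'cV[R]_d :=
  if n is n'.+1 then \bigcup_(l in [set` L]) (tau A l @` spectrum A L S n')
  else S.

End Vectors.

Section Complex.
Context {R : realType}.

Definition expi (t : R) : R[i] := cos t +i* sin t.

(* conjugate-linear in the first argument *)
Definition cdot {m : nat} (v w : 'cV[R[i]]_m) : R[i] := (v ^t* *m w) 0 0.

(* Rows and columns follow the enumerations of L and B. *)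
Definition fourier_mx {d : nat} (L B : {fset 'cV[R]_d}) :
    'M[R[i]]_(#|` L|, #|` B|) :=
  \matrix_(i, j) expi (2 * pi * dot (enum_fset L)`_i (enum_fset B)`_j).

End Complex.

Section L2.
Context {disp : measure_display} {T : measurableType disp} {R : realType}.
Variable mu : {measure set T -> \bar R}.
Implicit Type f : T -> R[i].

(* Meaningful for integrable f; it is only applied to products of a
   square-integrable function with a bounded one, for finite mu. *)
Definition cintegral f : R[i] :=
  (\int[mu]_x complex.Re (f x))%R +i* (\int[mu]_x complex.Im (f x))%R.

Definition sqnorm f : \bar R := (\int[mu]_x ((ComplexField.Normc.normc (f x)) ^+ 2)%:E)%E.

Definition in_L2 f : Prop :=
  [/\ measurable_fun [set: T] (fun x => complex.Re (f x)),
      measurable_fun [set: T] (fun x => complex.Im (f x))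
    & (sqnorm f < +oo)%E].

End L2.

Section Fourier.
Context {R : realType} {d : nat}.
Variable mu : {measure set (borelRd R d) -> \bar R}.
Implicit Type f : borelRd R d -> R[i].

Definition fourier f (lambda : 'cV[R]_d) : R[i] :=
  cintegral mu (fun x => f x * expi (- (2 * pi * dot lambda x))).

(* possibly infinite sum over an arbitrary, possibly uncountable, set *)
Definition fourier_energy (S : set 'cV[R]_d) f : \bar R :=
  (\esum_(lambda in S) ((ComplexField.Normc.normc (fourier f lambda)) ^+ 2)%:E)%E.

End Fourier.

(* Main.v *)
Require Import Defs.
From mathcomp Require Import all_boot all_order all_algebra.
From mathcomp Require Import finmap.
From mathcomp Require Import all_classical all_reals all_analysis.
From mathcomp Require Import complex.
From mathcomp Require Import measurable_realfun.
From mathcomp Require Import ring lra.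

(** The bounds propagate from one level to the next, each level multiplying the
    lower one by [delta / |B|] and the upper one by [D / |B|].

    Write [mu] for the measure of level [n], [nu] for that of level [n + 1],
    [S] for the spectrum of level [n] and [e(t)] for [exp(2 i pi t)].  Since
    [nu] is the average of the images of [mu] under the maps [sigma_b], an
    integral against [nu] is the integral against [mu] of an average over [B].
    The matrices in [tau] and [sigma] cancel:
    [tau_l(s) . sigma_b(x) = (s + l) . (x + b)].  Because [S] stays in the
    bipolar of [Lambda] and [B] in its polar, [s . b] is an integer, hence the
    transform of [f] at [tau_l(s)] is the transform, against [mu] and at [s],
    of the single function
    [g_l(x) = |B|^-1 sum_b f(sigma_b x) e(- l . (x + b))]
    ([fourier_transfer]).  The translates of the bipolar by the elements of [L]
    are disjoint, hence so are the sets [tau_l(S)] ([tau_inj]); the energy of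
    [f] is therefore the sum over [l] of the energies of the [g_l]
    ([esum_bigcup_tau]), and the bounds of level [n] compare it with
    [sum_l ||g_l||^2].

    For a fixed [x], the number [|B| |g_l(x)|] is the modulus of the [l]-th
    entry of the Fourier matrix [(e(l . b))] applied to the vector of the
    conjugates of the [f(sigma_b x)].  The hypothesis on the matrix thus bounds
    [|B|^2 sum_l |g_l(x)|^2] between [delta] and [D] times
    [sum_b |f(sigma_b x)|^2] ([sum_sqmod_transfer]), and integrating turns the
    latter sum into [|B| ||f||^2] ([sqnorm_transfer_bounds]). *)

Local Open Scope classical_set_scope.
Local Open Scope ring_scope.
Local Open Scope complex_scope.
Local Open Scope sesquilinear_scope.

(** * Squared moduli and the unimodular exponential *)

Section Modulus.
Context {R : realType}.
Implicit Types (z w : R[i]) (t u : R).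

Definition sqmod z : R := ComplexField.Normc.normc z ^+ 2.

Lemma sqmodE z : sqmod z = complex.Re z ^+ 2 + complex.Im z ^+ 2.
Proof. by case: z => a b; rewrite /sqmod /= sqr_sqrtr// addr_ge0 ?sqr_ge0. Qed.

Lemma sqmod_ge0 z : 0 <= sqmod z.
Proof. by rewrite /sqmod sqr_ge0. Qed.

Lemma sqmodM z w : sqmod (z * w) = sqmod z * sqmod w.
Proof. by rewrite /sqmod ComplexField.Normc.normcM exprMn. Qed.

Lemma sqmod_real t : sqmod t%:C = t ^+ 2.
Proof. by rewrite sqmodE /= expr0n addr0. Qed.

Lemma sqmod_conj z : sqmod z^*%C = sqmod z.
Proof. by case: z => a b; rewrite !sqmodE /= sqrrN. Qed.

Lemma sqmod_expi t : sqmod (expi t) = 1.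
Proof. by rewrite sqmodE /= cos2Dsin2. Qed.

Lemma sqmodC z : (sqmod z)%:C = z^*%C * z.
Proof. by rewrite sqmodE; case: z => a b; simpc; congr (_ +i* _); ring. Qed.

Lemma expiD t u : expi (t + u) = expi t * expi u.
Proof.
rewrite /expi cosD sinD; simpc.
by rewrite [sin t * cos u]mulrC addrC [X in _ +i* X]addrC.
Qed.

Lemma expiN t : expi (- t) = (expi t)^*%C.
Proof. by rewrite /expi cosN sinN. Qed.

Lemma expi_int (m : R) : m \is a Num.int -> expi (2 * pi * m) = 1.
Proof.
have expi_nat n : expi (2 * pi * n%:R) = 1 :> R[i].
  have -> : 2 * pi * n%:R = 0 + pi *+ 2 *+ n :> R.
    by rewrite add0r [2 * _]mulr_natl mulr_natr.
  rewrite /expi (periodicn (@cosD2pi R)) (periodicn (@sinD2pi R)).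
  by rewrite cos0 sin0.
move=> /intrP[[n|n] ->]; first exact: expi_nat.
by rewrite NegzE mulrNz mulrN expiN expi_nat conjc1.
Qed.

Lemma Re_sum (I : Type) (s : seq I) (F : I -> R[i]) :
  complex.Re (\sum_(i <- s) F i) = \sum_(i <- s) complex.Re (F i).
Proof. by apply: (big_morph (@complex.Re R)) => // -[a b] [c e]. Qed.

Lemma Im_sum (I : Type) (s : seq I) (F : I -> R[i]) :
  complex.Im (\sum_(i <- s) F i) = \sum_(i <- s) complex.Im (F i).
Proof. by apply: (big_morph (@complex.Im R)) => // -[a b] [c e]. Qed.

Lemma Re_realM t z : complex.Re (t%:C * z) = t * complex.Re z.
Proof. by case: z => a b; simpc. Qed.

Lemma Im_realM t z : complex.Im (t%:C * z) = t * complex.Im z.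
Proof. by case: z => a b; simpc. Qed.

Lemma cdot_sqmod (m : nat) (w : 'cV[R[i]]_m) :
  cdot w w = (\sum_(i < m) sqmod (w i 0))%:C.
Proof.
rewrite /cdot mxE rmorph_sum /=; apply: eq_bigr => i _.
by rewrite sqmodC !mxE.
Qed.

Lemma cdot_gram (m n : nat) (M : 'M[R[i]]_(m, n)) (v : 'cV[R[i]]_n) :
  cdot v (M ^t* *m M *m v) = cdot (M *m v) (M *m v).
Proof.
rewrite /cdot; congr (fun_of_matrix _ 0 0).
by rewrite trmx_mul map_mxM !mulmxA.
Qed.

(** Over a probability measure, this makes the real and imaginary parts of a
    square-integrable function integrable without the Cauchy-Schwarz
    inequality. *)
Lemma norm_le_1D_sqmod z t : t ^+ 2 <= sqmod z -> `|t| <= 1 + sqmod z.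
Proof.
move=> tz; rewrite ler_norml; apply/andP; split; nra.
Qed.

End Modulus.

(** * Integration against a scaled sum of image measures *)

Section ScaledSumOfImages.
Context {disp : measure_display} {T : measurableType disp} {R : realType}.
Context {I : Type}.
Variables (s : seq I) (phi : I -> T -> T).
Hypothesis mphi : forall i, measurable_fun [set: T] (phi i).
Variables (mu nu : {measure set T -> \bar R}) (r : {nonneg R}).
Hypothesis nuE : forall E, measurable E ->
  nu E = (r%:num%:E * \sum_(i <- s) mu (phi i @^-1` E))%E.

(** The sum of the image measures has to exist as a measure before its
    integrals can be computed; it is built one image at a time. *)
Lemma sum_images_measure : exists2 m : {measure set T -> \bar R},
  forall E, m E = (\sum_(i <- s) mu (phi i @^-1` E))%E &
  forall h : T -> \bar R, measurable_fun [set: T] h -> (forall x, 0 <= h x)%E ->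
    (\int[m]_x h x = \sum_(i <- s) \int[mu]_x h (phi i x))%E.
Proof.
elim: s => [|i s' [m mE mint]].
  exists mzero => [E|h mh h0]; first by rewrite big_nil.
  by rewrite big_nil integral_measure_zero.
pose image_i := [the {measure set T -> \bar R} of pushforward mu (phi i)].
pose m_i := image_i (mphi i).
exists (measure_add m_i m) => [E|h mh h0].
  by rewrite big_cons -mE; exact: (measure_addE m_i m).
rewrite ge0_integral_measure_add// big_cons mint//; congr (_ + _)%E.
exact: ge0_integral_pushforward.
Qed.

Lemma ge0_integral_sum_images (h : T -> \bar R) :
    measurable_fun [set: T] h -> (forall x, 0 <= h x)%E ->
  (\int[nu]_x h x = r%:num%:E * \sum_(i <- s) \int[mu]_x h (phi i x))%E.
Proof.
move=> mh h0; have [m mE mint] := sum_images_measure.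
rewrite (eq_measure_integral (mscale r m)); last first.
  by move=> E mE' _; rewrite nuE// -mE.
by rewrite ge0_integral_mscale// mint.
Qed.

Lemma ge0_integral_image_average (u : T -> R) :
    measurable_fun [set: T] u -> (forall x, 0 <= u x) ->
  (\int[nu]_x (u x)%:E
     = \int[mu]_x (r%:num * \sum_(i <- s) u (phi i x))%:E)%E.
Proof.
move=> mu_ u0; rewrite ge0_integral_sum_images; last 2 first.
- exact/measurable_EFinP.
- by move=> x; rewrite lee_fin.
have mu_phi i : measurable_fun [set: T] (fun x => (u (phi i x))%:E).
  by apply/measurable_EFinP; exact: measurableT_comp mu_ (mphi i).
rewrite -ge0_integral_sum//; last by move=> i x _; rewrite lee_fin.
rewrite -ge0_integralZl//.
- by apply: eq_integral => x _; rewrite EFinM sumEFin.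
- exact: emeasurable_sum.
- by move=> x _; apply: sume_ge0 => i _; rewrite lee_fin.
Qed.

(** The signed case follows by splitting into positive and negative parts: both
    averages have a finite integral, so the two integrals may be subtracted. *)
Lemma integral_image_average (u : T -> R) :
    nu.-integrable [set: T] (EFin \o u) ->
  (\int[nu]_x (u x)%:E
     = \int[mu]_x (r%:num * \sum_(i <- s) u (phi i x))%:E)%E.
Proof.
move=> iu; pose avg v x := r%:num * \sum_(i <- s) v (phi i x).
have avgI (v : T -> R) : measurable_fun [set: T] v -> (forall x, 0 <= v x) ->
    nu.-integrable [set: T] (EFin \o v) ->
  mu.-integrable [set: T] (EFin \o avg v).
  move=> mv v0 iv; apply/integrableP; split.
    apply/measurable_EFinP; apply: measurable_funM => //.
    by apply: measurable_sum => i; apply: measurableT_comp.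
  rewrite (eq_integral (EFin \o avg v)).
    by rewrite -ge0_integral_image_average// integrable_lty.
  by move=> x _; rewrite /= ger0_norm// mulr_ge0// sumr_ge0.
have iup := integrable_funrpos measurableT iu.
have iun := integrable_funrneg measurableT iu.
rewrite integralE.
have /measurable_EFinP mu_ : measurable_fun [set: T] (EFin \o u).
  by case/integrableP: iu.
have mup : measurable_fun [set: T] (u^\+)%R by exact: measurable_funrpos.
have mun : measurable_fun [set: T] (u^\-)%R by exact: measurable_funrneg.
have ipos := avgI _ mup (funrpos_ge0 u) iup.
have ineg := avgI _ mun (funrneg_ge0 u) iun.
rewrite funerpos funerneg !ge0_integral_image_average//.
rewrite -(integralB _ ipos ineg)//.
apply: eq_integral => x _; rewrite /= -EFinB -mulrBr -sumrB.
congr (_ * _)%:E; apply: eq_bigr => i _.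
exact: (congr1 (fun v => v (phi i x)) (funrposBneg u)).
Qed.

End ScaledSumOfImages.

(** * Polars and the structure of the spectra *)

Section Geometry.
Context {R : realType} {d : nat}.
Implicit Types (A : 'M[R]_d) (x y s t b l : 'cV[R]_d) (S Lambda : set 'cV[R]_d).

Lemma dotE x y : dot x y = (x^T *m y) 0 0.
Proof. by rewrite mxE; apply: eq_bigr => i _; rewrite mxE. Qed.

Lemma dotC x y : dot x y = dot y x.
Proof. by apply: eq_bigr => i _; rewrite mulrC. Qed.

Lemma dotDl x y t : dot (x + y) t = dot x t + dot y t.
Proof. by rewrite -big_split; apply: eq_bigr => i _; rewrite mxE mulrDl. Qed.

Lemma dotDr t x y : dot t (x + y) = dot t x + dot t y.
Proof. by rewrite dotC dotDl !(dotC _ t). Qed.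

Lemma dot_trmx A x y : dot (A^T *m x) y = dot x (A *m y).
Proof. by rewrite !dotE trmx_mul trmxK mulmxA. Qed.

Lemma dot_tau_sigma A l s b x : A \in unitmx ->
  dot (tau A l s) (sigma A b x) = dot (s + l) (x + b).
Proof. by move=> uA; rewrite dot_trmx mulKVmx. Qed.

(** [A^T] preserves the bipolar because [A] preserves the polar, and the
    translation by [l] contributes [A^T l], which lies in the bipolar. *)
Lemma polar_tau Lambda A l s :
    A \in unitmx -> [set A *m t | t in polar Lambda] `<=` polar Lambda ->
    [set invmx A^T *m t | t in polar (polar Lambda)] l ->
  polar (polar Lambda) s -> polar (polar Lambda) (tau A l s).
Proof.
move=> uA stable [u u_in <-] s_in t t_in; rewrite /tau mulmxDr.
rewrite mulKVmx ?unitmx_tr// dotDl rpredD ?(u_in t)// dot_trmx.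
by apply: s_in; apply: stable; exists t.
Qed.

Lemma spectrum_sub_bipolar Lambda A (L : {fset 'cV[R]_d}) (n : nat) :
    A \in unitmx -> [set A *m t | t in polar Lambda] `<=` polar Lambda ->
    [set` L] `<=` [set invmx A^T *m t | t in polar (polar Lambda)] ->
  spectrum A L Lambda n `<=` polar (polar Lambda).
Proof.
move=> uA stable subL; elim: n => [|n IHn] s /=.
  by move=> s_in t t_in; rewrite dotC; exact: t_in.
case=> l l_in [s' /IHn s'_in <-].
by apply: polar_tau => //; exact: subL.
Qed.

(** Injectivity on pairs encodes both that each [tau A l] is injective and that
    the images of [S] for different [l] are disjoint. *)
Lemma tau_inj S A (L : {fset 'cV[R]_d}) : A \in unitmx ->
    (forall l l', l \in L -> l' \in L -> l != l' ->
       translate l S `&` translate l' S = set0) ->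
  set_inj ([set` L] `*` S) (fun p => tau A p.1 p.2).
Proof.
move=> uA disj [l s] [l' s']; rewrite !inE /= => -[lL sS] [l'L s'S].
move=> /(can_inj (mulKmx _)); rewrite unitmx_tr => /(_ uA) e.
have [el|nl] := eqVneq l l'.
  by rewrite el in e *; rewrite (addIr _ e).
suff : set0 (s + l) by [].
by rewrite -(disj l l')//; split; [exists s|exists s'] => //; rewrite ?e addrC.
Qed.

(** The union is the injective image of a product, which allows a sum over an
    arbitrary, possibly uncountable, [S]. *)
Lemma esum_bigcup_tau (L : {fset 'cV[R]_d}) A S (a : 'cV[R]_d -> \bar R) :
    (forall x, 0 <= a x)%E ->
    set_inj ([set` L] `*` S) (fun p => tau A p.1 p.2) ->
  (\esum_(x in \bigcup_(l in [set` L]) (tau A l @` S)) a x =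
   \sum_(l <- L) \esum_(s in S) a (tau A l s))%E.
Proof.
move=> a0 inj.
have -> : \bigcup_(l in [set` L]) (tau A l @` S) =
    (fun p => tau A p.1 p.2) @` ([set` L] `*` S).
  apply/seteqP; split => [x [l lL [s sS <-]]|x [[l s] [/= lL sS] <-]].
    by exists (l, s).
  by exists l => //; exists s.
rewrite esum_image// -(@esum_esum _ _ _ _ (fun=> S) (fun l s => a (tau A l s)))//.
rewrite esum_fset//; last by move=> l _; exact: esum_ge0.
by rewrite fsbig_finite//= set_fsetK.
Qed.

End Geometry.

(** * Measurability and integrability *)

Section Measurability.
Context {R : realType} {d : nat}.

Lemma continuous_cV_measurable (h : 'cV[R]_d -> 'cV[R]_d) : continuous h ->
  @measurable_fun _ _ (borelRd R d) (borelRd R d) [set: borelRd R d] h.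
Proof.
move=> /continuousP ch.
apply: (@measurability _ _ (borelRd R d) (borelRd R d) _ _
  (@open 'cV[R]_d) erefl).
move=> _ [U oU <-].
by rewrite setTI; apply: sub_sigma_algebra; exact: ch.
Qed.

Lemma continuous_real_measurable (h : 'cV[R]_d -> R) : continuous h ->
  @measurable_fun _ _ (borelRd R d) R [set: borelRd R d] h.
Proof.
move=> /continuousP ch; apply: (measurability _ (RGenOpens.measurableE R)).
move=> _ [_ [a [b ->] <-]].
rewrite setTI; apply: sub_sigma_algebra; apply: ch; exact: interval_open.
Qed.

Lemma continuous_linear_form (I : Type) (s : seq I) (c : I -> R) (j : I -> 'I_d) :
  continuous (fun x : 'cV[R]_d => \sum_(i <- s) c i * x (j i) 0).
Proof.
elim: s => [|i s IHs] x.
  rewrite (_ : (fun _ => _) = cst 0); last by apply/funext => y; rewrite big_nil.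
  apply: (@cst_continuous _ _ (0:R)).
rewrite (_ : (fun _ => _) = (fun y : 'cV[R]_d => c i * y (j i) 0)
    \+ (fun y : 'cV[R]_d => \sum_(k <- s) c k * y (j k) 0)); last first.
  by apply/funext => y; rewrite big_cons.
apply: continuousD; last exact: IHs.
by apply: continuousM; [exact: cst_continuous|exact: coord_continuous].
Qed.

Lemma continuous_dot (u : 'cV[R]_d) : continuous (fun x : 'cV[R]_d => dot u x).
Proof. exact: continuous_linear_form. Qed.

(** The topology of column vectors is that of coordinatewise convergence, and
    each coordinate of [sigma A b] is a linear form plus a constant. *)
Lemma continuous_sigma (A : 'M[R]_d) (b : 'cV[R]_d) : continuous (sigma A b).
Proof.
move=> x V [P P_nbhs subV].
suff : \forall y \near x, forall i, P i 0 (sigma A b y i 0).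
  apply: filterS => y Py; apply: subV => i j.
  by rewrite ord1; exact: Py.
apply: (@filter_forall _ _ (fun i y => P i 0 (sigma A b y i 0)) (nbhs x)) => i.
have : continuous (fun y : 'cV[R]_d =>
    \sum_(k < d) invmx A i k * y k 0 + \sum_(k < d) invmx A i k * b k 0).
  move=> y; apply: continuousD; last exact: cst_continuous.
  exact: continuous_linear_form.
move=> /(_ x (P i 0)).
have E (y : 'cV[R]_d) :
    \sum_(k < d) invmx A i k * y k 0 + \sum_(k < d) invmx A i k * b k 0
    = sigma A b y i 0.
  by rewrite -big_split mxE; apply: eq_bigr => k _; rewrite !mxE mulrDr.
rewrite E => /(_ (P_nbhs i 0)).
by apply: (@filterS _ (nbhs x)) => y /=; rewrite E.
Qed.

Lemma measurable_sigma (A : 'M[R]_d) (b : 'cV[R]_d) :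
  @measurable_fun _ _ (borelRd R d) (borelRd R d) [set: borelRd R d] (sigma A b).
Proof. by apply: continuous_cV_measurable; exact: continuous_sigma. Qed.

Lemma measurable_dot (u : 'cV[R]_d) :
  @measurable_fun _ _ (borelRd R d) R [set: borelRd R d] (dot u).
Proof. by apply: continuous_real_measurable; exact: continuous_dot. Qed.

End Measurability.

Section ComplexMeasurability.
Context {disp : measure_display} {T : measurableType disp} {R : realType}.
Implicit Types (f g : T -> R[i]) (u : T -> R).

Definition cmeasurable f : Prop :=
  measurable_fun [set: T] (fun x => complex.Re (f x)) /\
  measurable_fun [set: T] (fun x => complex.Im (f x)).

Lemma cmeasurableM f g : cmeasurable f -> cmeasurable g ->
  cmeasurable (fun x => f x * g x).
Proof.
move=> [rf jf] [rg jg]; split.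
  have -> : (fun x => complex.Re (f x * g x)) =
      (fun x => complex.Re (f x) * complex.Re (g x))
      \- (fun x => complex.Im (f x) * complex.Im (g x)).
    by apply/funext => x /=; case: (f x) (g x) => [a b] [c e].
  by apply: measurable_funB; exact: measurable_funM.
have -> : (fun x => complex.Im (f x * g x)) =
    (fun x => complex.Re (f x) * complex.Im (g x))
    \+ (fun x => complex.Im (f x) * complex.Re (g x)).
  by apply/funext => x /=; case: (f x) (g x) => [a b] [c e].
by apply: measurable_funD; exact: measurable_funM.
Qed.

Lemma cmeasurable_cst (c : R[i]) : cmeasurable (fun=> c).
Proof. by split; exact: measurable_cst. Qed.

Lemma cmeasurable_sum (I : Type) (s : seq I) (F : I -> T -> R[i]) :
  (forall i, cmeasurable (F i)) -> cmeasurable (fun x => \sum_(i <- s) F i x).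
Proof.
move=> mF; split.
  under eq_fun do rewrite Re_sum.
  by apply: measurable_sum => i; case: (mF i).
under eq_fun do rewrite Im_sum.
by apply: measurable_sum => i; case: (mF i).
Qed.

Lemma cmeasurable_expi u : measurable_fun [set: T] u ->
  cmeasurable (fun x => expi (u x)).
Proof.
move=> mu_; split; apply: measurableT_comp => //.
  by apply: continuous_measurable_fun; exact: continuous_cos.
by apply: continuous_measurable_fun; exact: continuous_sin.
Qed.

Lemma measurable_sqmod f : cmeasurable f ->
  measurable_fun [set: T] (fun x => sqmod (f x)).
Proof.
move=> [rf jf]; under eq_fun do rewrite sqmodE.
by apply: measurable_funD; apply: measurable_funX.
Qed.

(** A function dominated by [1 + |f|^2] is integrable over a probability
    measure, and multiplying by [e] does not change the modulus. *)
Lemma in_L2_unimodular_integrable (nu : probability T R) f (e : T -> R[i]) :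
    in_L2 nu f -> cmeasurable e -> (forall x, sqmod (e x) = 1) ->
  nu.-integrable [set: T] (fun x => (complex.Re (f x * e x))%:E) /\
  nu.-integrable [set: T] (fun x => (complex.Im (f x * e x))%:E).
Proof.
move=> [rf jf f2] me e1.
have mf : cmeasurable f by [].
have [rfe jfe] := cmeasurableM _ _ mf me.
have dom : nu.-integrable [set: T] (EFin \o (fun x => 1 + sqmod (f x))).
  have -> : EFin \o (fun x => 1 + sqmod (f x)) =
    (EFin \o cst 1) \+ (EFin \o (fun x => sqmod (f x))) by [].
  apply: integrableD => //; first exact: finite_measure_integrable_cst.
  apply/integrableP; split.
    by apply/measurable_EFinP; exact: measurable_sqmod.
  under eq_integral => x _ do rewrite /= ger0_norm ?sqmod_ge0//.
  exact: f2.
have fe x : sqmod (f x * e x) = sqmod (f x) by rewrite sqmodM e1 mulr1.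
split; apply: le_integrable dom => //.
- exact/measurable_EFinP.
- move=> x _; rewrite /= lee_fin [leRHS]ger0_norm ?addr_ge0 ?sqmod_ge0// -fe.
  by apply: norm_le_1D_sqmod; rewrite sqmodE lerDl sqr_ge0.
- exact/measurable_EFinP.
- move=> x _; rewrite /= lee_fin [leRHS]ger0_norm ?addr_ge0 ?sqmod_ge0// -fe.
  by apply: norm_le_1D_sqmod; rewrite sqmodE lerDr sqr_ge0.
Qed.

End ComplexMeasurability.

(** * Transferring a function one level down *)

Section Transfer.
Context {R : realType} {d : nat}.
Variables (A : 'M[R]_d) (B L : {fset 'cV[R]_d}).
Hypothesis A_inv : A \in unitmx.
Implicit Types (f : borelRd R d -> R[i]) (l s b x : 'cV[R]_d).

(** The function [g_l] whose transform at [s] is that of [f] at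
    [tau A l s]. *)
Definition transfer l f x : R[i] :=
  ((#|` B|%:R)^-1)%:C *
  \sum_(b <- B) f (sigma A b x) * expi (- (2 * pi * dot l (x + b))).

Lemma cmeasurable_comp_sigma f b : cmeasurable f ->
  cmeasurable (fun x : borelRd R d => f (sigma A b x)).
Proof.
move=> [rf jf]; split.
  exact: measurableT_comp rf (measurable_sigma A b).
exact: measurableT_comp jf (measurable_sigma A b).
Qed.

Lemma cmeasurable_transfer l f : cmeasurable f ->
  cmeasurable (transfer l f : borelRd R d -> _).
Proof.
move=> mf; apply: cmeasurableM; first exact: cmeasurable_cst.
apply: cmeasurable_sum => b; apply: cmeasurableM.
  exact: cmeasurable_comp_sigma.
apply: cmeasurable_expi.
under eq_fun do rewrite dotDr -mulrN.
apply: measurable_funM => //; apply: measurableT_comp => //.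
by apply: measurable_funD => //; exact: measurable_dot.
Qed.

(** The phase [(s + l) . (x + b)] splits into [s . x], [l . (x + b)] and the
    integer [s . b], whose exponential is 1. *)
Lemma transfer_character l s f x : (forall b, b \in B -> dot s b \is a Num.int) ->
  ((#|` B|%:R)^-1)%:C *
    (\sum_(b <- B) f (sigma A b x) *
       expi (- (2 * pi * dot (tau A l s) (sigma A b x)))) =
  transfer l f x * expi (- (2 * pi * dot s x)).
Proof.
move=> sB; rewrite /transfer -mulrA mulr_suml; congr (_ * _).
rewrite big_seq [RHS]big_seq; apply: eq_bigr => b bB.
rewrite dot_tau_sigma// dotDl (dotDr s) -[RHS]mulrA; congr (_ * _).
have -> : - (2 * pi * (dot s x + dot s b + dot l (x + b))) =
    - (2 * pi * dot l (x + b)) + - (2 * pi * dot s x)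
    + 2 * pi * - dot s b by ring.
by rewrite !expiD expi_int ?mulr1// rpredN sB.
Qed.

(** Up to a factor of modulus 1, [|B|] times the conjugate of [g_l(x)] is the
    [l]-th entry of the Fourier matrix applied to the conjugated values of [f]
    at the points [sigma A b x]. *)
Lemma sum_sqmod_transfer (delta D : R) f x :
    (forall v : 'cV[R[i]]_#|` B|,
     delta%:C * cdot v v
       <= cdot v ((fourier_mx L B) ^t* *m fourier_mx L B *m v)
       <= D%:C * cdot v v) ->
  delta * \sum_(b <- B) sqmod (f (sigma A b x))
    <= #|` B|%:R ^+ 2 * \sum_(l <- L) sqmod (transfer l f x)
    <= D * \sum_(b <- B) sqmod (f (sigma A b x)).
Proof.
move=> bounds; have [B0|B0] := eqVneq #|` B| 0%N.
  have /cardfs0_eq -> := B0.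
  by rewrite cardfs0 !big_seq_fset0 !mulr0 expr0n mul0r lexx.
(* Conjugating turns the phases [- l . b] of [transfer] into those of the
   matrix. *)
pose v : 'cV[R[i]]_#|` B| := \col_j (f (sigma A (enum_fset B)`_j x))^*%C.
have vv : cdot v v = (\sum_(b <- B) sqmod (f (sigma A b x)))%:C.
  rewrite cdot_sqmod; congr (_%:C).
  rewrite (big_nth 0) big_mkord; apply: eq_bigr => j _.
  by rewrite mxE sqmod_conj.
have Mv : cdot v ((fourier_mx L B) ^t* *m fourier_mx L B *m v) =
    (#|` B|%:R ^+ 2 * \sum_(l <- L) sqmod (transfer l f x))%:C.
  rewrite cdot_gram cdot_sqmod; congr (_%:C).
  rewrite mulr_sumr (big_nth 0) big_mkord; apply: eq_bigr => i _.
  set l := (enum_fset L)`_i.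
  rewrite /transfer sqmodM sqmod_real mulrA -exprMn.
  rewrite mulfV ?pnatr_eq0// expr1n mul1r.
  rewrite -[RHS]sqmod_conj rmorph_sum /=.
  (* The factor depending on [x] alone leaves every summand in [b]. *)
  have shift z : sqmod z = sqmod (expi (- (2 * pi * dot l x)) * z).
    by rewrite sqmodM sqmod_expi mul1r.
  rewrite [RHS]shift mulr_sumr mxE (big_nth 0) big_mkord; congr sqmod.
  apply: eq_bigr => j _.
  have conjM (z w : R[i]) : (z * w)^*%C = z^*%C * w^*%C by exact: rmorphM.
  rewrite !mxE conjM -expiN opprK dotDr (mulrDr (2 * pi) (dot l x)) expiD mulrC.
  rewrite [RHS]mulrCA; congr (_ * _); rewrite mulrA -expiD addNr.
  by rewrite /expi cos0 sin0 mul1r.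
by have := bounds v; rewrite vv Mv -!rmorphM /= !lecR.
Qed.

End Transfer.

(** * Frame bounds from one level to the next *)

Section Step.
Context {R : realType} {d : nat}.
Variables (A : 'M[R]_d) (B L : {fset 'cV[R]_d}).
Hypothesis A_inv : A \in unitmx.
Variables mu nu : probability (borelRd R d) R.
Hypothesis nuE : forall E : set (borelRd R d), measurable E ->
  nu E = (((#|` B|%:R)^-1)%:E * \sum_(b <- B) mu (sigma A b @^-1` E))%E.
Variables (delta D : R).
Hypotheses (delta_gt0 : 0 < delta) (delta_le_D : delta <= D).
Hypothesis bounds : forall v : 'cV[R[i]]_#|` B|,
  delta%:C * cdot v v
    <= cdot v ((fourier_mx L B) ^t* *m fourier_mx L B *m v)
    <= D%:C * cdot v v.
Implicit Types (f : borelRd R d -> R[i]) (l s x : 'cV[R]_d) (S : set 'cV[R]_d).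

Local Notation N := (#|` B|%:R : R).
Local Notation g := (@transfer R d A B).

(** Were [B] empty, [nu] would vanish although it has mass 1. *)
Lemma card_branches_gt0 : 0 < N.
Proof.
rewrite ltr0n lt0n; apply/negP => /eqP B0.
have := nuE setT measurableT.
rewrite B0 invr0 mul0e probability_setT => /eqP.
by rewrite eqe oner_eq0.
Qed.

Lemma sqnormE (m : {measure set (borelRd R d) -> \bar R}) f :
  sqnorm m f = (\int[m]_x (sqmod (f x))%:E)%E.
Proof. by []. Qed.

Let mphi b : @measurable_fun _ _ (borelRd R d) (borelRd R d) setT (sigma A b).
Proof. exact: measurable_sigma. Qed.

Let nuE' (E : set (borelRd R d)) : measurable E ->
  nu E = (((N^-1)%:nng)%:num%:E * \sum_(b <- B) mu (sigma A b @^-1` E))%E.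
Proof. exact: nuE. Qed.

Lemma sqnorm_average f : cmeasurable f ->
  sqnorm nu f = (\int[mu]_x (N^-1 * \sum_(b <- B) sqmod (f (sigma A b x)))%:E)%E.
Proof.
move=> mf; rewrite sqnormE.
apply: (ge0_integral_image_average _ _ mphi _ _ _ nuE').
  exact: measurable_sqmod.
by move=> x; exact: sqmod_ge0.
Qed.

Lemma fourier_transfer f l s : (forall b, b \in B -> dot s b \is a Num.int) ->
  in_L2 nu f -> fourier nu f (tau A l s) = fourier mu (g l f) s.
Proof.
move=> sB f2; rewrite /fourier /cintegral.
pose e x := expi (- (2 * pi * dot (tau A l s) x)) : R[i].
have me : cmeasurable (e : borelRd R d -> R[i]).
  apply: cmeasurable_expi; under eq_fun do rewrite -mulrN.
  apply: measurable_funM => //; apply: measurableT_comp => //.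
  exact: measurable_dot.
have [iR iI] := in_L2_unimodular_integrable _ _ _ f2 me (fun x => sqmod_expi _).
rewrite /Rintegral.
have -> := integral_image_average _ _ mphi _ _ _ nuE' _ iR.
have -> := integral_image_average _ _ mphi _ _ _ nuE' _ iI.
congr (fine _ +i* fine _); apply: eq_integral => x _; congr (_%:E).
  by rewrite -(transfer_character _ _ A_inv _ _ _ _ sB) Re_realM Re_sum.
by rewrite -(transfer_character _ _ A_inv _ _ _ _ sB) Im_realM Im_sum.
Qed.

(** The pointwise bounds carry a factor [|B|^-2], of which averaging over [B]
    absorbs one power. *)
Lemma sqnorm_transfer_bounds f : cmeasurable f ->
  ((delta / N)%:E * sqnorm nu f <= \sum_(l <- L) sqnorm mu (g l f))%E /\
  (\sum_(l <- L) sqnorm mu (g l f) <= (D / N)%:E * sqnorm nu f)%E.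
Proof.
move=> mf; have N0 := card_branches_gt0.
pose u x := N^-1 * \sum_(b <- B) sqmod (f (sigma A b x)).
pose w x := \sum_(l <- L) sqmod (g l f x).
have u0 x : 0 <= u x.
  by rewrite mulr_ge0 ?invr_ge0 ?sumr_ge0// => b _; exact: sqmod_ge0.
have w0 x : 0 <= w x by rewrite sumr_ge0// => l _; exact: sqmod_ge0.
have mu_ : measurable_fun [set: borelRd R d] (EFin \o u).
  apply/measurable_EFinP; apply: measurable_funM => //.
  apply: measurable_sum => b; apply: measurable_sqmod.
  exact: cmeasurable_comp_sigma.
have mg l : measurable_fun [set: borelRd R d]
    (EFin \o (fun x => sqmod (g l f x))).
  apply/measurable_EFinP; apply: measurable_sqmod.
  exact: cmeasurable_transfer.
have mw : measurable_fun [set: borelRd R d] (EFin \o w).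
  apply/measurable_EFinP; apply: measurable_sum => l.
  by apply/measurable_EFinP; exact: mg.
have -> : (\sum_(l <- L) sqnorm mu (g l f) = \int[mu]_x (w x)%:E)%E.
  rewrite -ge0_integral_sum//; last by move=> l x _; rewrite lee_fin sqmod_ge0.
  by apply: eq_integral => x _; rewrite sumEFin.
have uw x : delta / N * u x <= w x <= D / N * u x.
  have /andP[lo hi] := sum_sqmod_transfer A B L delta D f x bounds.
  have e c : c / N * u x =
      (N ^+ 2)^-1 * (c * \sum_(b <- B) sqmod (f (sigma A b x))).
    by rewrite /u; field; rewrite gt_eqF.
  have N2 : 0 < N ^+ 2 by rewrite exprn_gt0.
  by rewrite !e ler_pdivrMl// ler_pdivlMl// lo hi.
have intZ c : 0 <= c ->
    (c%:E * \int[mu]_x (u x)%:E = \int[mu]_x (c * u x)%:E)%E.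
  move=> c0; rewrite -ge0_integralZl//.
  by move=> x _; rewrite lee_fin.
have mcu c : measurable_fun [set: borelRd R d] (fun x => (c * u x)%:E).
  by apply/measurable_EFinP; apply: measurable_funM => //; apply/measurable_EFinP.
have D0 : 0 < D by exact: lt_le_trans delta_le_D.
rewrite sqnorm_average// !intZ ?divr_ge0 ?(ltW D0) ?(ltW delta_gt0) ?(ltW N0)//.
split; apply: ge0_le_integral => //.
- by move=> x _; rewrite lee_fin mulr_ge0 ?divr_ge0 ?(ltW delta_gt0) ?(ltW N0).
- by move=> x _; rewrite lee_fin; have /andP[] := uw x.
- by move=> x _; rewrite lee_fin.
- by move=> x _; rewrite lee_fin; have /andP[] := uw x.
Qed.

(** Finiteness comes from the upper bound on the sum of all the
    [||g_l||^2]. *)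
Lemma in_L2_transfer f l : l \in L -> in_L2 nu f -> in_L2 mu (g l f).
Proof.
move=> lL [rf jf f2]; have mf : cmeasurable f by [].
have [rg jg] := cmeasurable_transfer A B l f mf; split => //.
apply: (@le_lt_trans _ _ (\sum_(l <- L) sqnorm mu (g l f))%E).
  rewrite (big_fsetD1 l)//= leeDl// sume_ge0// => l' _.
  by apply: integral_ge0 => x _; rewrite lee_fin sqr_ge0.
apply: le_lt_trans (sqnorm_transfer_bounds f mf).2 _.
rewrite lte_mul_pinfty// lee_fin divr_ge0 ?(ltW card_branches_gt0)//.
by rewrite (le_trans (ltW delta_gt0)).
Qed.

Lemma frame_bounds_step S (k K : R) : 0 <= k -> 0 <= K ->
    (forall s b, S s -> b \in B -> dot s b \is a Num.int) ->
    set_inj ([set` L] `*` S) (fun p => tau A p.1 p.2) ->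
    (forall f, in_L2 mu f ->
      (k%:E * sqnorm mu f <= fourier_energy mu S f)%E /\
      (fourier_energy mu S f <= K%:E * sqnorm mu f)%E) ->
  forall f, in_L2 nu f ->
    let S' := \bigcup_(l in [set` L]) (tau A l @` S) in
    ((k * (delta / N))%:E * sqnorm nu f <= fourier_energy nu S' f)%E /\
    (fourier_energy nu S' f <= (K * (D / N))%:E * sqnorm nu f)%E.
Proof.
move=> k0 K0 SB inj frame f f2 S'.
have mf : cmeasurable f by case: f2.
have -> : fourier_energy nu S' f = (\sum_(l <- L) fourier_energy mu S (g l f))%E.
  rewrite /fourier_energy esum_bigcup_tau//; last by move=> x; rewrite lee_fin sqr_ge0.
  apply: eq_bigr => l _; apply: eq_esum => s Ss.
  by rewrite fourier_transfer// => b; exact: SB.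
have [lo hi] := sqnorm_transfer_bounds f mf.
have Q0 l : (0 <= sqnorm mu (g l f))%E.
  by apply: integral_ge0 => x _; rewrite lee_fin sqr_ge0.
rewrite !EFinM -!muleA; split.
  apply: (@le_trans _ _ (k%:E * \sum_(l <- L) sqnorm mu (g l f))%E).
    by apply: lee_wpmul2l; rewrite ?lee_fin// muleA -EFinM.
  rewrite ge0_sume_distrr// big_seq [leRHS]big_seq; apply: lee_sum => l lL.
  by have [] := frame _ (in_L2_transfer f l lL f2).
apply: (@le_trans _ _ (K%:E * \sum_(l <- L) sqnorm mu (g l f))%E); last first.
  by apply: lee_wpmul2l; rewrite ?lee_fin// muleA -EFinM.
rewrite ge0_sume_distrr// big_seq [leRHS]big_seq; apply: lee_sum => l lL.
by have [] := frame _ (in_L2_transfer f l lL f2).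
Qed.

End Step.

Theorem theorem3p1p5 (R : realType) (d : nat)
  (Lambda : set 'cV[R]_d) (B L : {fset 'cV[R]_d}) (A : 'M[R]_d)
  (A_inv : A \in unitmx)
  (cond_i : \rank (fourier_mx L B) = #|` B|)
  (cond_ii : [set A *m t | t in polar Lambda] `<=` polar Lambda)
  (cond_iii : [set` B] `<=` polar Lambda)
  (cond_iv : [set` L] `<=` [set invmx A^T *m t | t in polar (polar Lambda)])
  (cond_v : forall l l' : 'cV[R]_d, l \in L -> l' \in L -> l != l' ->
     translate l (polar (polar Lambda)) `&` translate l' (polar (polar Lambda))
     = set0)
  (mu : nat -> probability (borelRd R d) R)
  (mu_rec : forall (n : nat) (E : set (borelRd R d)), measurable E ->
     mu n.+1 E =
     (((#|` B|%:R)^-1)%:E * \sum_(b <- B) mu n (sigma A b @^-1` E))%E)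
  (k K : R) (k_gt0 : 0 < k) (k_le_K : k <= K)
  (frame0 : forall f : borelRd R d -> R[i], in_L2 (mu 0%N) f ->
     (k%:E * sqnorm (mu 0%N) f
        <= fourier_energy (mu 0%N) (spectrum A L Lambda 0) f)%E /\
     (fourier_energy (mu 0%N) (spectrum A L Lambda 0) f
        <= K%:E * sqnorm (mu 0%N) f)%E)
  (delta D : R) (delta_gt0 : 0 < delta) (delta_le_D : delta <= D)
  (mx_bounds : forall v : 'cV[R[i]]_#|` B|,
     delta%:C * cdot v v
       <= cdot v ((fourier_mx L B) ^t* *m fourier_mx L B *m v)
       <= D%:C * cdot v v) :
  forall (n : nat) (f : borelRd R d -> R[i]), in_L2 (mu n) f ->
    ((k * (delta / #|` B|%:R) ^+ n)%:E * sqnorm (mu n) f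
       <= fourier_energy (mu n) (spectrum A L Lambda n) f)%E /\
    (fourier_energy (mu n) (spectrum A L Lambda n) f
       <= (K * (D / #|` B|%:R) ^+ n)%:E * sqnorm (mu n) f)%E.
Proof.
elim=> [|n IHn] f; first by rewrite !expr0 !mulr1; exact: frame0.
have bipolar := spectrum_sub_bipolar Lambda A L n A_inv cond_ii cond_iv.
have K_ge0 : 0 <= K by rewrite (le_trans (ltW k_gt0)).
have D_ge0 : 0 <= D by rewrite (le_trans (ltW delta_gt0)).
rewrite !exprSr !mulrA -!(mulrA (_ * _ ^+ n)).
apply: (frame_bounds_step _ _ _ A_inv _ _ (mu_rec n)) => //.
- by rewrite mulr_ge0 ?exprn_ge0 ?divr_ge0 ?(ltW k_gt0) ?(ltW delta_gt0).
- by rewrite mulr_ge0 ?exprn_ge0 ?divr_ge0.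
- by move=> s b /bipolar s_in bB; apply: s_in; exact: cond_iii.
apply: sub_in2 (tau_inj (polar (polar Lambda)) A L A_inv cond_v).
by move=> [l s]; rewrite !inE => -[lL /bipolar].
Qed.
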